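(* Let $X$ be a countably infinite set. There are no non-singular mixed identities for the symmetric group $\mathrm{Sym}(X)$ (in any finite number $r$ of variables).
   Context: $\mathrm{Sym}(X)$ is the group of all bijections of $X$. For a group $G$ and the free group $\mathbf F_r=\langle x_1,\dots,x_r\rangle$, a word with constants in $G$ is an element $w\in G\ast\mathbf F_r$. For $g_1,\dots,g_r\in G$, $w(g_1,\dots,g_r)\in G$ denotes the image of $w$ under the homomorphism $G\ast\mathbf F_r\to G$ that is the identity on $G$ and sends $x_i\mapsto g_i$. The word $w$ is a mixed identity for $G$ if $w\neq1$ in $G\ast\mathbf F_r$ and $w(g_1,\dots,g_r)=1_G$ for all $g_1,\dots,g_r\in G$. Let $\epsilon\colon G\ast\mathbf F_r\to\mathbf F_r$ be the homomorphism that sends every element of $G$ to $1$ and is the identity on $\mathbf F_r$; $w$ is singular if $\epsilon(w)=1$ and non-singular otherwise. *)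

(* Defs.v *)
From HB Require Import structures.
From mathcomp Require Import all_boot.
From mathcomp Require Import boolp classical_sets functions cardinality.

Set Implicit Arguments.
Unset Strict Implicit.
Unset Printing Implicit Defensive.

Import Algebra.

Local Open Scope group_scope.
Local Open Scope quotient_scope.

(* Sequences over [L] modulo the congruence generated by [R], i.e. the monoid
   with generators [L] and relations [u = v] for [R u v].                     *)
Section PresentedMonoid.
Variables (L : choiceType) (R : seq L -> seq L -> Prop).

Inductive congr : seq L -> seq L -> Prop :=
| congr_step s u v t : R u v -> congr (s ++ u ++ t) (s ++ v ++ t)
| congr_refl s : congr s s
| congr_sym s t : congr s t -> congr t s
| congr_trans s t u : congr s t -> congr t u -> congr s u.

Lemma congr_cat s s' t t' :
  congr s s' -> congr t t' -> congr (s ++ t) (s' ++ t').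
Proof.
move=> ss' tt'; apply: (@congr_trans _ (s' ++ t)).
- elim: ss' => [a u v b Ruv|a|a b _|a b c _ ab _].
  + by rewrite -!catA; exact: congr_step.
  + exact: congr_refl.
  + exact: congr_sym.
  + exact: congr_trans.
- elim: tt' => [a u v b Ruv|a|a b _|a b c _ ab _].
  + by rewrite !(catA s'); exact: congr_step.
  + exact: congr_refl.
  + exact: congr_sym.
  + exact: congr_trans.
Qed.

Definition congrb : rel (seq L) := fun s t => `[< congr s t >].

Lemma congrb_refl : reflexive congrb.
Proof. by move=> s; apply/asboolP; exact: congr_refl. Qed.

Lemma congrb_sym : symmetric congrb.
Proof.
by move=> s t; apply/asboolP/asboolP => h; apply: congr_sym.
Qed.

Lemma congrb_trans : transitive congrb.
Proof.
by move=> t s u /asboolP st /asboolP tu; apply/asboolP; apply: congr_trans tu.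
Qed.

Canonical congr_equiv := EquivRel congrb congrb_refl congrb_sym congrb_trans.

Definition presented := {eq_quot congr_equiv}.
HB.instance Definition _ := Choice.on presented.
HB.instance Definition _ := Quotient.on presented.

Definition cls (s : seq L) : presented := \pi_presented s.

Lemma clsP s t : cls s = cls t <-> congr s t.
Proof. by split=> [/eqmodP/asboolP|h]; last exact/eqmodP/asboolP. Qed.

Lemma cls_repr (w : presented) : cls (repr w) = w.
Proof. exact: reprK. Qed.

Definition presented_mul (v w : presented) : presented :=
  cls (repr v ++ repr w).

Lemma cls_cat s t : cls (s ++ t) = presented_mul (cls s) (cls t).
Proof.
by apply/clsP; apply: congr_cat; apply/clsP; rewrite cls_repr.
Qed.

Fact presented_mulA : associative presented_mul.
Proof.
move=> u v w; rewrite -(cls_repr u) -(cls_repr v) -(cls_repr w).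
by rewrite -!cls_cat catA.
Qed.

Fact presented_mul1w : left_id (cls [::]) presented_mul.
Proof. by move=> w; rewrite -(cls_repr w) -cls_cat. Qed.

Fact presented_mulw1 : right_id (cls [::]) presented_mul.
Proof. by move=> w; rewrite -(cls_repr w) -cls_cat cats0. Qed.

HB.instance Definition _ := isMonoid.Build presented
  presented_mulA presented_mul1w presented_mulw1.

Lemma clsM s t : cls (s ++ t) = cls s * cls t.
Proof. exact: cls_cat. Qed.

Lemma cls_nil : cls [::] = 1.
Proof. by []. Qed.

Lemma cls_rel u v : R u v -> cls u = cls v.
Proof.
by move=> Ruv; apply/clsP; have := congr_step [::] [::] Ruv; rewrite !cats0.
Qed.

Lemma prod_repr_cls (M : monoidType) (phi : L -> M) :
    (forall u v, R u v -> \prod_(l <- u) phi l = \prod_(l <- v) phi l) ->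
  forall s, \prod_(l <- repr (cls s)) phi l = \prod_(l <- s) phi l.
Proof.
move=> phiR s.
have /clsP : cls (repr (cls s)) = cls s by rewrite cls_repr.
move: (repr _) => t; elim=> [a u v b Ruv|//|a b _ -> //|a b c _ -> _ -> //].
by rewrite !big_cat /= (phiR _ _ Ruv).
Qed.

Variable linv : L -> L.
Hypothesis linvK : forall l, cls [:: linv l; l] = 1.
Hypothesis linKv : forall l, cls [:: l; linv l] = 1.

Definition seq_inv (s : seq L) := rev (map linv s).

Lemma seq_invl s : cls (seq_inv s) * cls s = 1.
Proof.
elim: s => [|l s IHs]; first by rewrite -clsM.
rewrite /seq_inv /= rev_cons -cats1 -/(seq_inv s) -(cat1s l) !clsM.
by rewrite -mulgA (mulgA (cls [:: linv l])) -(clsM [:: _] [:: _]) linvK mul1g.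
Qed.

Lemma seq_invr s : cls s * cls (seq_inv s) = 1.
Proof.
elim: s => [|l s IHs]; first by rewrite -clsM.
rewrite /seq_inv /= rev_cons -cats1 -/(seq_inv s) -(cat1s l) !clsM.
by rewrite -mulgA (mulgA (cls s)) IHs mul1g -(clsM [:: _] [:: _]) linKv.
Qed.

End PresentedMonoid.

(* The letter [(i, false)] is x_i and [(i, true)] is x_i^-1. *)
Section FreeGroup.
Variable I : choiceType.

Variant cancel_rel : seq (I * bool) -> seq (I * bool) -> Prop :=
| CancelRel i b : cancel_rel [:: (i, b); (i, ~~ b)] [::].

Definition free_group := presented cancel_rel.
HB.instance Definition _ := Monoid.on free_group.

Definition free_linv (l : I * bool) := (l.1, ~~ l.2).

Fact free_linvl l : cls cancel_rel [:: free_linv l; l] = 1.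
Proof.
by case: l => i b; apply: cls_rel; rewrite -{2}(negbK b); constructor.
Qed.

Fact free_linvr l : cls cancel_rel [:: l; free_linv l] = 1.
Proof. by case: l => i b; apply: cls_rel; constructor. Qed.

Definition free_inv (w : free_group) : free_group :=
  cls cancel_rel (seq_inv free_linv (repr w)).

Fact free_mulVg : left_inverse 1 free_inv *%g.
Proof. by move=> w; rewrite -{2}(cls_repr w) seq_invl//; exact: free_linvl. Qed.

Fact free_mulgV : right_inverse 1 free_inv *%g.
Proof. by move=> w; rewrite -{1}(cls_repr w) seq_invr//; exact: free_linvr. Qed.

HB.instance Definition _ := hasInv.Build free_group free_inv.
HB.instance Definition _ :=
  Monoid_isGroup.Build free_group free_mulVg free_mulgV.

Definition free_gen (i : I) : free_group := cls cancel_rel [:: (i, false)].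

(* The homomorphism to [K] sending each generator [i] to [g i]; it is computed
   on a representative, and [free_lift_cls] shows the choice is irrelevant.   *)
Variables (K : groupType) (g : I -> K).

Definition free_letter (l : I * bool) : K := if l.2 then (g l.1)^-1 else g l.1.

Definition free_lift (w : free_group) : K := \prod_(l <- repr w) free_letter l.

Lemma free_lift_cls s :
  free_lift (cls cancel_rel s) = \prod_(l <- s) free_letter l.
Proof.
apply: prod_repr_cls => _ _ [i b]; rewrite big_cons big_seq1 big_nil.
by case: b; rewrite /free_letter /= ?mulgV ?mulVg.
Qed.

Fact free_lift_mul : {morph free_lift : v w / v * w}.
Proof.
move=> v w; rewrite -(cls_repr v) -(cls_repr w) -clsM !free_lift_cls.
by rewrite big_cat.
Qed.
HB.instance Definition _ := isMultiplicative.Build _ _ free_lift free_lift_mul.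

Fact free_lift_1 : free_lift 1 = 1.
Proof. by rewrite -cls_nil free_lift_cls big_nil. Qed.
HB.instance Definition _ :=
  Multiplicative_isUMagmaMorphism.Build _ _ free_lift free_lift_1.

Lemma free_lift_gen i : free_lift (free_gen i) = g i.
Proof. by rewrite free_lift_cls big_seq1. Qed.

End FreeGroup.

Section FreeProduct.
Variables G H : groupType.

Variant free_prod_rel : seq (G + H) -> seq (G + H) -> Prop :=
| FreeProdOneL : free_prod_rel [:: inl 1] [::]
| FreeProdOneR : free_prod_rel [:: inr 1] [::]
| FreeProdMulL a b : free_prod_rel [:: inl a; inl b] [:: inl (a * b)]
| FreeProdMulR a b : free_prod_rel [:: inr a; inr b] [:: inr (a * b)].

Definition free_prod := presented free_prod_rel.
HB.instance Definition _ := Monoid.on free_prod.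

Definition free_prod_linv (l : G + H) : G + H :=
  match l with inl a => inl a^-1 | inr b => inr b^-1 end.

Fact free_prod_linvl l : cls free_prod_rel [:: free_prod_linv l; l] = 1.
Proof.
case: l => a /=.
- by rewrite (cls_rel (FreeProdMulL _ _)) mulVg (cls_rel FreeProdOneL).
- by rewrite (cls_rel (FreeProdMulR _ _)) mulVg (cls_rel FreeProdOneR).
Qed.

Fact free_prod_linvr l : cls free_prod_rel [:: l; free_prod_linv l] = 1.
Proof.
case: l => a /=.
- by rewrite (cls_rel (FreeProdMulL _ _)) mulgV (cls_rel FreeProdOneL).
- by rewrite (cls_rel (FreeProdMulR _ _)) mulgV (cls_rel FreeProdOneR).
Qed.

Definition free_prod_inv (w : free_prod) : free_prod :=
  cls free_prod_rel (seq_inv free_prod_linv (repr w)).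

Fact free_prod_mulVg : left_inverse 1 free_prod_inv *%g.
Proof.
by move=> w; rewrite -{2}(cls_repr w) seq_invl//; exact: free_prod_linvl.
Qed.

Fact free_prod_mulgV : right_inverse 1 free_prod_inv *%g.
Proof.
by move=> w; rewrite -{1}(cls_repr w) seq_invr//; exact: free_prod_linvr.
Qed.

HB.instance Definition _ := hasInv.Build free_prod free_prod_inv.
HB.instance Definition _ :=
  Monoid_isGroup.Build free_prod free_prod_mulVg free_prod_mulgV.

Definition free_prod_inl (a : G) : free_prod := cls free_prod_rel [:: inl a].
Definition free_prod_inr (b : H) : free_prod := cls free_prod_rel [:: inr b].

Fact free_prod_inl_mul : {morph free_prod_inl : a b / a * b}.
Proof.
by move=> a b; rewrite /free_prod_inl -clsM (cls_rel (FreeProdMulL _ _)).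
Qed.
HB.instance Definition _ :=
  isMultiplicative.Build _ _ free_prod_inl free_prod_inl_mul.

Fact free_prod_inl_1 : free_prod_inl 1 = 1.
Proof. exact: cls_rel FreeProdOneL. Qed.
HB.instance Definition _ :=
  Multiplicative_isUMagmaMorphism.Build _ _ free_prod_inl free_prod_inl_1.

Fact free_prod_inr_mul : {morph free_prod_inr : a b / a * b}.
Proof.
by move=> a b; rewrite /free_prod_inr -clsM (cls_rel (FreeProdMulR _ _)).
Qed.
HB.instance Definition _ :=
  isMultiplicative.Build _ _ free_prod_inr free_prod_inr_mul.

Fact free_prod_inr_1 : free_prod_inr 1 = 1.
Proof. exact: cls_rel FreeProdOneR. Qed.
HB.instance Definition _ :=
  Multiplicative_isUMagmaMorphism.Build _ _ free_prod_inr free_prod_inr_1.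

(* The homomorphism to [K] restricting to [f] on [G] and to [g] on [H]; again
   independent of the representative, by [free_prod_lift_cls].                *)
Variables (K : groupType).
Variables (f : UMagmaMorphism.type G K) (g : UMagmaMorphism.type H K).

Definition free_prod_letter (l : G + H) : K :=
  match l with inl a => f a | inr b => g b end.

Definition free_prod_lift (w : free_prod) : K :=
  \prod_(l <- repr w) free_prod_letter l.

Lemma free_prod_lift_cls s :
  free_prod_lift (cls free_prod_rel s) = \prod_(l <- s) free_prod_letter l.
Proof.
apply: prod_repr_cls => _ _ [||a b|a b]; rewrite !big_cons !big_nil /= ?mulg1.
- exact: gmulf1.
- exact: gmulf1.
- by rewrite gmulfM.
- by rewrite gmulfM.
Qed.

Fact free_prod_lift_mul : {morph free_prod_lift : v w / v * w}.
Proof.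
move=> v w; rewrite -(cls_repr v) -(cls_repr w) -clsM !free_prod_lift_cls.
by rewrite big_cat.
Qed.
HB.instance Definition _ :=
  isMultiplicative.Build _ _ free_prod_lift free_prod_lift_mul.

Fact free_prod_lift_1 : free_prod_lift 1 = 1.
Proof. by rewrite -cls_nil free_prod_lift_cls big_nil. Qed.
HB.instance Definition _ :=
  Multiplicative_isUMagmaMorphism.Build _ _ free_prod_lift free_prod_lift_1.

Lemma free_prod_lift_inl a : free_prod_lift (free_prod_inl a) = f a.
Proof. by rewrite free_prod_lift_cls big_seq1. Qed.

Lemma free_prod_lift_inr b : free_prod_lift (free_prod_inr b) = g b.
Proof. by rewrite free_prod_lift_cls big_seq1. Qed.

End FreeProduct.

Section MixedIdentities.
Variables (G : groupType) (r : nat).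

Definition const_word := free_prod G (free_group 'I_r).
HB.instance Definition _ := Group.on const_word.

Definition word_const (a : G) : const_word := free_prod_inl _ a.
Definition word_var (i : 'I_r) : const_word := free_prod_inr G (free_gen i).

Definition word_eval (g : 'I_r -> G) : const_word -> G :=
  free_prod_lift idfun (free_lift g).

Lemma word_eval_const g a : word_eval g (word_const a) = a.
Proof. exact: free_prod_lift_inl. Qed.

Lemma word_eval_var g i : word_eval g (word_var i) = g i.
Proof. by rewrite /word_eval free_prod_lift_inr /= free_lift_gen. Qed.

Definition mixed_identity (w : const_word) : Prop :=
  w <> 1 /\ forall g : 'I_r -> G, word_eval g w = 1.

Definition word_augm : const_word -> free_group 'I_r :=
  free_prod_lift (@one_fun G (free_group 'I_r)) idfun.

Lemma word_augm_const a : word_augm (word_const a) = 1.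
Proof. exact: free_prod_lift_inl. Qed.

Lemma word_augm_var i : word_augm (word_var i) = free_gen i.
Proof. exact: free_prod_lift_inr. Qed.

Definition singular (w : const_word) : Prop := word_augm w = 1.

Definition non_singular (w : const_word) : Prop := ~ singular w.

End MixedIdentities.

(* The product [s * t] is the composite [s \o t]. *)
Record Sym (X : Type) := MkSym {
  sym_fun :> X -> X;
  sym_bij : bijective sym_fun
}.

Section SymmetricGroup.
Variable X : Type.
Implicit Types s t u : Sym X.

HB.instance Definition _ := gen_eqMixin (Sym X).
HB.instance Definition _ := gen_choiceMixin (Sym X).

Lemma symP s t : (forall x, s x = t x) -> s = t.
Proof.
case: s t => [f bf] [g bg] /= /funext fg; case: g / fg bg => bg.
by congr MkSym; exact: Prop_irrelevance.
Qed.

Definition sym_one : Sym X :=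
  MkSym (Bijective (fun=> erefl) (fun=> erefl) : bijective id).

Definition sym_mul s t : Sym X :=
  MkSym (bij_comp (sym_bij s) (sym_bij t)).

Fact sym_inv_exists s : exists t, cancel s t /\ cancel t s.
Proof.
case: (sym_bij s) => g sK gK.
by exists (MkSym (Bijective gK sK)).
Qed.

Definition sym_inv s : Sym X := sval (cid (sym_inv_exists s)).

Lemma symK s : cancel s (sym_inv s).
Proof. by rewrite /sym_inv; case: cid => t []. Qed.

Lemma symKV s : cancel (sym_inv s) s.
Proof. by rewrite /sym_inv; case: cid => t []. Qed.

Fact sym_mulA : associative sym_mul.
Proof. by move=> s t u; apply: symP. Qed.

Fact sym_mul1s : left_id sym_one sym_mul.
Proof. by move=> s; apply: symP. Qed.

Fact sym_muls1 : right_id sym_one sym_mul.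
Proof. by move=> s; apply: symP. Qed.

Fact sym_mulVs : left_inverse sym_one sym_inv sym_mul.
Proof. by move=> s; apply: symP => x /=; rewrite symK. Qed.

Fact sym_mulsV : right_inverse sym_one sym_inv sym_mul.
Proof. by move=> s; apply: symP => x /=; rewrite symKV. Qed.

HB.instance Definition _ := isGroup.Build (Sym X)
  sym_mulA sym_mul1s sym_muls1 sym_mulVs sym_mulsV.

End SymmetricGroup.

(* Main.v *)
From HB Require Import structures.
Require Import Defs.
From mathcomp Require Import all_boot.
From mathcomp Require Import classical_sets cardinality.
From mathcomp Require Import boolp.

(* Let [w = c_0 x_1 c_1 ... x_n c_n], where the [x_j] are variables or inverses
   of variables and [eps(w) <> 1]. We show that [w(g)] can be made to move
   arbitrarily many points.
   If some [x_(j+1) = x_j^-1] and [c_j] has finite support [S], then deleting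
   [x_j c_j x_(j+1)] changes [w(g)] at no more than [|S|] points, a bound that
   does not depend on [g], and leaves [eps(w)] unchanged; so induct on [n].
   If no such [j] exists, follow a point through [w] from right to left,
   sending it under each [x_j] to a fresh point [q]. When [x_j] is the inverse
   of [x_(j-1)], choose [q] among the infinitely many points moved by
   [c_(j-1)], so that the trajectory never backtracks. This prescribes finite
   partial injections, which extend to permutations, and it can be repeated
   for any number of starting points.                                         *)

Set Implicit Arguments.
Unset Strict Implicit.
Unset Printing Implicit Defensive.

Import Algebra.

Local Open Scope group_scope.

(** * Normal form of words with constants *)

Section Words.
Variables (G : groupType) (r : nat).
Local Notation letter := ('I_r * bool)%type.
Implicit Types (g : 'I_r -> G) (u : seq (letter * G)).

(** Each letter is paired with the constant to its right. The leading constant of a word is kept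
    apart, so that it can be moved to the other side of an equation. *)
Definition word_val g u : G := \prod_(p <- u) (free_letter g p.1 * p.2).

Definition word_shape u : free_group 'I_r :=
  \prod_(p <- u) free_letter (@free_gen 'I_r) p.1.

Lemma word_val_cons g p u :
  word_val g (p :: u) = free_letter g p.1 * p.2 * word_val g u.
Proof. by rewrite /word_val big_cons. Qed.

Lemma word_val_cat g u v : word_val g (u ++ v) = word_val g u * word_val g v.
Proof. by rewrite /word_val big_cat. Qed.

Lemma word_shape_cons p u :
  word_shape (p :: u) = free_letter (@free_gen 'I_r) p.1 * word_shape u.
Proof. by rewrite /word_shape big_cons. Qed.

Lemma word_shape_cat u v : word_shape (u ++ v) = word_shape u * word_shape v.
Proof. by rewrite /word_shape big_cat. Qed.

Lemma free_letter_linv (K : groupType) (h : 'I_r -> K) l :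
  free_letter h (free_linv l) = (free_letter h l)^-1.
Proof. by case: l => i []; rewrite /free_letter //= invgK. Qed.

Lemma free_linvK : involutive (@free_linv 'I_r).
Proof. by case=> i b; rewrite /free_linv /= negbK. Qed.

Lemma free_linv_neq (l : letter) : free_linv l != l.
Proof. by case: l => i []; apply/eqP => -[]. Qed.

Lemma free_letter_gen (l : letter) :
  free_letter (@free_gen 'I_r) l = cls (@cancel_rel 'I_r) [:: l].
Proof.
case: l => i []; rewrite /free_letter //=.
apply: (mulgI (free_gen i)); rewrite mulgV -clsM.
exact/esym/(free_linvr (i, false)).
Qed.

Lemma free_prod_letters (s : seq letter) :
  cls (@cancel_rel 'I_r) s = \prod_(l <- s) free_letter (@free_gen 'I_r) l.
Proof.
elim: s => [|l s IHs]; first by rewrite big_nil.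
by rewrite big_cons -IHs free_letter_gen -clsM.
Qed.

(** Induction on a representative, from the right: a constant is absorbed into [c], while an element
    of the free group is spelled out, its last letter taking [c] as partner and each letter leaving
    [1] as leading constant. *)
Lemma const_word_normal_form (w : const_word G r) :
  exists c u, (forall g, word_eval g w = c * word_val g u)
            /\ word_augm w = word_shape u.
Proof.
rewrite -(cls_repr w); move: (repr w) => {w}.
elim=> [|[a|b] s [c [u [valE augmE]]]].
- exists 1, [::]; split=> [g|]; rewrite /word_val /word_shape.
    by rewrite /word_eval free_prod_lift_cls !big_nil mulg1.
  by rewrite /word_augm free_prod_lift_cls !big_nil.
- exists (a * c), u; split=> [g|].
    by rewrite -mulgA -valE /word_eval !free_prod_lift_cls big_cons.
  by rewrite -augmE /word_augm !free_prod_lift_cls big_cons mul1g.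
have augmSE : word_augm (cls (@free_prod_rel _ _) (inr b :: s) : const_word G r)
    = b * word_shape u.
  by rewrite -augmE /word_augm !free_prod_lift_cls big_cons.
have valSE g : word_eval g (cls (@free_prod_rel _ _) (inr b :: s))
    = free_lift g b * (c * word_val g u).
  by rewrite -valE /word_eval !free_prod_lift_cls big_cons.
suff [c' [u' [H1 H2]]] : exists c' u',
    (forall g, free_lift g b * (c * word_val g u) = c' * word_val g u')
    /\ b * word_shape u = word_shape u'.
  by exists c', u'; split=> [g|]; rewrite ?valSE ?augmSE.
rewrite -(cls_repr b) free_prod_letters; move: (repr b) => t.
have liftE g : free_lift g (\prod_(l <- t) free_letter (@free_gen 'I_r) l)
    = \prod_(l <- t) free_letter g l.
  by rewrite -free_prod_letters free_lift_cls.
suff [c' [u' [H1 H2]]] : exists c' u',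
    (forall g, \prod_(l <- t) free_letter g l * (c * word_val g u)
       = c' * word_val g u')
    /\ \prod_(l <- t) free_letter (@free_gen 'I_r) l * word_shape u
       = word_shape u'.
  by exists c', u'; split=> [g|]; rewrite ?liftE.
elim: t {liftE} => [|l t [c' [u' [H1 H2]]]].
  by exists c, u; split=> [g|]; rewrite big_nil mul1g.
exists 1, ((l, c') :: u'); split=> [g|].
  by rewrite big_cons -mulgA H1 word_val_cons /= mul1g mulgA.
by rewrite big_cons -mulgA H2 word_shape_cons.
Qed.

End Words.

Lemma not_sorted_split (T : Type) (e : rel T) s :
  ~~ sorted e s -> exists s1 x y s2, s = s1 ++ [:: x, y & s2] /\ ~~ e x y.
Proof.
elim: s => // x [|y s] // IHs /=; rewrite negb_and => /orP[nexy|].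
  by exists [::], x, y, s.
move=> /IHs[s1 [x' [y' [s2 [-> ne]]]]].
by exists (x :: s1), x', y', s2.
Qed.

(** * Partial injections and their extension to permutations *)

Section Permutations.
Variables (X : eqType) (r : nat).
Hypothesis Xinf : forall S : seq X, exists x, x \notin S.
Local Notation letter := ('I_r * bool)%type.
Implicit Types (c d : Sym X) (g : 'I_r -> Sym X).

Definition transp_fun (a b z : X) :=
  if z == a then b else if z == b then a else z.

Lemma transp_funK a b : involutive (transp_fun a b).
Proof.
move=> z; rewrite /transp_fun; have [->|za] := eqVneq z a.
  by rewrite eqxx; have [|] := eqVneq b a.
by have [->|zb] := eqVneq z b; rewrite ?eqxx // (negbTE za) (negbTE zb).
Qed.

Definition transp a b : Sym X := MkSym (inv_bij (transp_funK a b)).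

Lemma symM c d x : (c * d) x = c (d x). Proof. by []. Qed.

Lemma sym1 x : (1 : Sym X) x = x. Proof. by []. Qed.

Lemma symVK c x : c^-1 (c x) = x. Proof. exact: symK. Qed.

Lemma sym_inj c : injective c. Proof. exact: can_inj (symVK c). Qed.

(** Composing with the transposition of [c a] and [b] corrects the value at [a]; by injectivity it
    fixes the values prescribed by the pairs other than [(a, b)]. *)
Lemma extend_partial_bij (E : seq (X * X)) :
    (forall p q, p \in E -> q \in E -> (p.1 == q.1) = (p.2 == q.2)) ->
  exists c, forall p, p \in E -> c p.1 = p.2.
Proof.
elim: E => [|[a b] E IHE] injE; first by exists 1.
have [p q pE qE|c cE] := IHE.
  by apply: injE; rewrite in_cons (pE, qE) orbT.
exists (transp (c a) b * c) => p; rewrite in_cons symM /= /transp_fun.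
case: eqVneq => [-> _ /=|_ /= pE]; first by rewrite eqxx.
have := injE p (a, b); rewrite !in_cons pE eqxx orbT => /(_ isT isT) /=.
rewrite (inj_eq (@sym_inj c)) cE //.
by case: eqVneq => [_ /esym/eqP->|_ <-].
Qed.

Definition finitary c := exists S : seq X, forall x, x \notin S -> c x = x.

Lemma not_finitary c :
  ~ finitary c -> forall S : seq X, exists2 x, x \notin S & c x != x.
Proof.
move=> ncf S; apply: contrapT => nex; apply: ncf; exists S => x xS.
by apply/eqP; apply: contrapT => /negP cx; apply: nex; exists x.
Qed.

(* An edge [(l, a, b)] prescribes that the value of the letter [l] maps
   [a] to [b].                                                                *)
Implicit Types (R : seq (letter * X * X)).

Definition edges_sym R :=
  forall l a b, (l, a, b) \in R -> (free_linv l, b, a) \in R.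

Definition edges_functional R :=
  forall l a b b', (l, a, b) \in R -> (l, a, b') \in R -> b = b'.

Definition realizes g R :=
  forall l a b, (l, a, b) \in R -> free_letter g l a = b.

Definition vertices R : seq X := [seq e.1.2 | e <- R].

Lemma vertices_edge R l a b : (l, a, b) \in R -> a \in vertices R.
Proof. by move=> labR; apply/mapP; exists (l, a, b). Qed.

(** By symmetry, functionality at the inverse letter is injectivity at the letter, so each variable
    gets a finite partial injection. *)
Lemma realizable R :
  edges_sym R -> edges_functional R -> exists g, realizes g R.
Proof.
move=> Rsym Rfun.
have H i : exists c, forall a b, ((i, false), a, b) \in R -> c a = b.
  pose E := [seq (e.1.2, e.2) | e <- R & e.1.1 == (i, false)].
  have memE a b : (a, b) \in E = (((i, false), a, b) \in R).
    apply/mapP/idP => [[[[l a'] b']]|abR].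
      by rewrite mem_filter /= => /andP[/eqP-> ?] [-> ->].
    by exists ((i, false), a, b); rewrite // mem_filter eqxx.
  have [[a b] [a' b']|c cE] := @extend_partial_bij E.
    rewrite !memE /= => abR a'b'R; apply/eqP/eqP => [aa'|bb'].
      by rewrite -aa' in a'b'R; exact: Rfun abR a'b'R.
    move: (Rsym _ _ _ abR) (Rsym _ _ _ a'b'R); rewrite -bb'.
    exact: Rfun.
  by exists c => a b; rewrite -memE => /cE.
have [g gR] := choice H.
exists g => -[i []] a b abR; rewrite /free_letter /=; last exact: gR.
by rewrite -(gR i b a) ?symVK //; exact: (Rsym _ _ _ abR).
Qed.

(** By symmetry [vertices R] also contains all targets, so [b] meets no edge of [R]. The two new
    edges do not clash even if [a = b], as their letters differ. *)
Lemma add_edge R l a b : edges_sym R -> edges_functional R ->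
    (forall b', (l, a, b') \notin R) -> b \notin vertices R ->
  edges_sym [:: (l, a, b), (free_linv l, b, a) & R]
  /\ edges_functional [:: (l, a, b), (free_linv l, b, a) & R].
Proof.
move=> Rsym Rfun laR bR; split.
  move=> l' a' b'; rewrite !inE => /or3P[/eqP[-> -> ->]|/eqP[-> -> ->]|/Rsym->].
  - by rewrite eqxx orbT.
  - by rewrite free_linvK eqxx.
  - by rewrite !orbT.
have lN : (l == free_linv l) = false by rewrite eq_sym (negbTE (free_linv_neq l)).
move=> l' a' b1 b2; rewrite !inE.
have laF b' : ((l, a, b') \in R) = false by apply/negbTE.
have bF l0 b' : ((l0, b, b') \in R) = false.
  by apply/negP => /vertices_edge; apply/negP.
case/or3P=> [/eqP[-> -> ->]|/eqP[-> -> ->]|H1].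
- case/or3P=> [/eqP[->] //|/eqP[lE]|]; last by rewrite laF.
  by move: lN; rewrite -lE eqxx.
- case/or3P=> [/eqP[lE]|/eqP[->] //|]; last by rewrite bF.
  by move: lN; rewrite lE eqxx.
case/or3P=> [/eqP[E1 E2 _]|/eqP[E1 E2 _]|].
- by move: H1; rewrite E1 E2 laF.
- by move: H1; rewrite E2 bF.
- exact: Rfun H1.
Qed.

(** * Irreducible words and fresh trajectories *)

Definition irreducible_pair (p q : letter * Sym X) : bool :=
  ~~ ((p.1 == free_linv q.1) && `[< finitary p.2 >]).

(* The condition on [(l, c q)] allows the next edge to be attached at [c q]. *)
Lemma fresh_trajectory d (u : seq (letter * Sym X)) (l : letter) c R
    (V : seq X) :
    path irreducible_pair (l, c) u -> edges_sym R -> edges_functional R ->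
  exists p q R',
  [/\ {subset R <= R'}, edges_sym R' & edges_functional R'] /\
  [/\ p \notin V, u <> [::] -> q <> d p,
      forall b, (l, c q, b) \notin R'
    & forall g, realizes g R' -> word_val g u p = q].
Proof.
elim: u l c => [|[l1 c1] u IHu] l c /=.
  move=> _ Rsym Rfun.
  have [p] := Xinf (V ++ map (c^-1)%g (vertices R)).
  rewrite mem_cat negb_or => /andP[pV cpR].
  exists p, p, R; do !split=> //.
    move=> b; apply/negP => /vertices_edge cp; move/negP: cpR; apply.
    by apply/mapP; exists (c p); rewrite ?symVK.
  by move=> g _; rewrite /word_val big_nil.
case/andP=> irr /IHu{}IHu Rsym Rfun.
have [p [q1 [R1 [[RR1 R1sym R1fun] [pV _ c1q1 val1]]]]] := IHu Rsym Rfun.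
pose a := c1 q1.
(* Avoiding these points gives in turn [q <> d p], a new vertex [q], and a point [c q] that is
   neither [a] nor an old vertex. *)
pose S := d p :: vertices R1 ++ map (c^-1)%g (a :: vertices R1).
(* The one remaining danger is [c q = q], where the reverse edge labelled [free_linv l1] starts. It
   matters only if [l] is that letter, and then irreducibility makes [c] move infinitely many
   points. *)
have [q qS cqq] : exists2 q, q \notin S & l = free_linv l1 -> c q != q.
  case: (eqVneq l (free_linv l1)) irr => [-> /=|ll1 _].
    rewrite /irreducible_pair /= eqxx /= => /asboolPn/not_finitary/(_ S)[q].
    by exists q.
  by have [q qS] := Xinf S; exists q => // ll1'; rewrite ll1' eqxx in ll1.
move: qS; rewrite /S in_cons mem_cat 2!negb_or => /and3P[qdp qR1 cqS].
have cqaR : c q \notin a :: vertices R1.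
  apply/negP => cq; move/negP: cqS; apply.
  by apply/mapP; exists (c q); rewrite ?symVK.
have [R'sym R'fun] := add_edge R1sym R1fun c1q1 qR1.
exists p, q, [:: (l1, a, q), (free_linv l1, q, a) & R1]; do !split=> //.
- by move=> e eR; rewrite !inE RR1 ?orbT.
- by move=> _; apply/eqP.
- move=> b; rewrite !inE !xpair_eqE; move: cqaR; rewrite in_cons negb_or.
  case/andP=> /negbTE-> cqR1; rewrite !andbF /= negb_or.
  apply/andP; split; last first.
    by apply/negP => /vertices_edge; apply/negP.
  by case: eqP => // /cqq/negbTE->.
- move=> g gR'; rewrite word_val_cons !symM val1.
    by apply: gR'; rewrite inE eqxx.
  by move=> l' a' b' H; apply: gR'; rewrite !inE H !orbT.
Qed.

(** Comparing with any [d], not just [1], lets constants at the left end be absorbed; asking for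
    many points leaves room to discard some. *)
Definition moves_many d (u : seq (letter * Sym X)) :=
  forall n, exists g s, [/\ uniq s, n <= size s
    & {in s, forall p, word_val g u p <> d p}].

Lemma irreducible_moves_many d u :
  u <> [::] -> sorted irreducible_pair u -> moves_many d u.
Proof.
case: u => // -[l c] u _ irr n; pose w := (l, c) :: u.
have [R [s [[Rsym Rfun] [us ss Rw]]]] : exists R s,
    (edges_sym R /\ edges_functional R) /\
    [/\ uniq s, n <= size s
      & forall g, realizes g R -> {in s, forall p, word_val g w p <> d p}].
  elim: n => [|n [R [s [[Rsym Rfun] [us ss Rw]]]]].
    by exists [::], [::].
  (* Repeating the first letter in front never creates an inverse pair. *)
  have irrw : path irreducible_pair (l, 1) w.
    apply/andP; split; last exact: irr.
    by rewrite /irreducible_pair /= eq_sym (negbTE (free_linv_neq l)).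
  have [p [q [R' [[RR' R'sym R'fun] [ps qd _ val]]]]] :=
    fresh_trajectory d s irrw Rsym Rfun.
  exists R', (p :: s); split=> //; split; rewrite //= ?ps // => g gR' p'.
  rewrite in_cons => /orP[/eqP->|p's]; first by rewrite val //; exact: qd.
  by apply: Rw p's => l' a b /RR'/gR'.
have [g gR] := realizable Rsym Rfun.
by exists g, s; split=> //; exact: Rw.
Qed.

(** * Reduction to irreducible words *)

(** As [m] does not depend on [g], one can ask for [n + m] points and discard those in [S]. *)
Lemma moves_many_transfer d d' u u' (m : nat) :
    (forall g, exists2 S : seq X, size S <= m & forall p, p \notin S ->
       word_val g u p = d p -> word_val g u' p = d' p) ->
  moves_many d' u' -> moves_many d u.
Proof.
move=> uu' mm n; have [g [s [us ss sP]]] := mm (n + m)%N.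
have [S Sm SP] := uu' g.
exists g, [seq p <- s | p \notin S]; split; first exact: filter_uniq.
  have : count (mem S) s <= m.
    rewrite -size_filter; apply: leq_trans Sm; apply: uniq_leq_size.
      exact: filter_uniq.
    by move=> p; rewrite mem_filter => /andP[].
  move: ss; rewrite size_filter -(count_predC (mem S) s) addnC => h h'.
  by rewrite -(leq_add2r m) addnC (leq_trans h) // addnC leq_add2l.
by move=> p; rewrite mem_filter => /andP[pS /sP wp /(SP _ pS)].
Qed.

Lemma nontrivial_shape_moves_many d u : word_shape u <> 1 -> moves_many d u.
Proof.
have [n] := ubnP (size u); elim: n d u => // n IHn d u; rewrite ltnS => un sh.
have [irr|] := boolP (sorted irreducible_pair u).
  apply: irreducible_moves_many => // u0; apply: sh.
  by rewrite u0 /word_shape big_nil.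
move=> /not_sorted_split[u1 [[l0 c] [[l c'] [u2 [uE]]]]].
rewrite /irreducible_pair negbK /= => /andP[/eqP l0E /asboolP[S cS]].
rewrite {l0}l0E in uE.
(* The starting points whose trajectory lies in [S] when [c] is about to act. *)
pose S' g := map (free_letter g l * c' * word_val g u2)^-1%g S.
have key g p : p \notin S' g ->
    word_val g u p = word_val g u1 (c' (word_val g u2 p)).
  move=> pS'; rewrite uE word_val_cat !word_val_cons /= cS.
    by rewrite free_letter_linv symVK.
  apply: contra pS' => H; apply/mapP.
  exists (free_letter g l (c' (word_val g u2 p))) => //.
  exact/esym/(symVK (free_letter g l * c' * word_val g u2)).
have shE : word_shape u = word_shape u1 * word_shape u2.
  rewrite uE word_shape_cat !word_shape_cons /= free_letter_linv.
  by rewrite (mulgA _^-1) mulVg mul1g.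
have szS' g : size (S' g) <= size S by rewrite size_map.
have szu : (size u1 + size u2).+1 < size u by rewrite uE size_cat /= !addnS.
(* The freed constant [c'] joins the constant before it; if no letter precedes, it passes into
   [d]. *)
case/lastP: u1 {uE} key shE szu => [|u1 [l1 c1]] key shE szu.
  apply: (@moves_many_transfer _ (c'^-1 * d) _ u2 (size S)); last first.
    apply: IHn; first by apply: leq_trans un; apply: leq_trans szu; rewrite ltnS.
    by move=> sh2; apply: sh; rewrite shE sh2 mulg1 /word_shape big_nil.
  move=> g; exists (S' g) => // p pS.
  by rewrite key // /word_val big_nil sym1 symM => <-; rewrite symVK.
apply: (@moves_many_transfer _ d _ (u1 ++ (l1, c1 * c') :: u2) (size S)).
  move=> g; exists (S' g) => // p pS; rewrite key // => <-.
  by rewrite -cats1 !word_val_cat !word_val_cons /word_val big_nil mulg1 !symM.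
apply: IHn.
  apply: leq_trans un; apply: leq_trans szu.
  by rewrite size_cat size_rcons /= addnS addSn ltnS.
move=> sh'; apply: sh; rewrite shE -sh' -cats1 !word_shape_cat !word_shape_cons.
by rewrite /word_shape big_nil mulg1 mulgA.
Qed.

End Permutations.

(** Number the points by naturals and take one numbered above all of [S]. *)
Lemma card_eq_nat_fresh (X : eqType) :
    ([set: X]%classic #= [set: nat]%classic)%card ->
  forall S : seq X, exists x, x \notin S.
Proof.
move=> /card_set_bijP[f [_ _ fsurj]] S.
have [x _ fx] := fsurj (\max_(y <- S) f y).+1 I.
exists x; apply/negP => xS.
by have := @leq_bigmax_seq _ S xpredT f x xS isT; rewrite fx ltnn.
Qed.

Theorem theorem3p1p1 (X : Type) (r : nat) :
  ([set: X]%classic #= [set: nat]%classic)%card ->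
  ~ exists w : const_word (Sym X) r, mixed_identity w /\ non_singular w.
Proof.
move=> cardX [w [[_ w1] wns]].
pose Y : eqType := HB.pack X (gen_eqMixin X).
have [c [u [valE augmE]]] := const_word_normal_form w.
have shu : word_shape u <> 1 by rewrite -augmE.
(* A mixed identity forces [word_val g u = c^-1] for every [g], so a single point of disagreement
   with [c^-1] suffices. *)
have [g [[|p s] [//= _ _ sP]]] :=
  @nontrivial_shape_moves_many Y r (@card_eq_nat_fresh Y cardX) c^-1 u shu 1%N.
apply: (sP p (mem_head _ _)).
suff -> : word_val g u = c^-1 by [].
by apply: (mulgI c); rewrite mulgV -valE.
Qed.
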